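(* Let $N\ge 2$ be an integer, $s\in(0,1)$, $p\ge 1$, $x_0\in\mathbb{R}^N$, $r>0$, $c>0$, $\alpha\in(0,1)$, $\gamma>0$, and $\delta,\lambda\in(0,1)$. Then there exists $\eta\in(0,1)$, independent of $u$ (i.e. determined by the data just listed), such that the following holds. For every $u\in W^{s,p}(Q_r(x_0))$ satisfying (a) $\big|\{x\in Q_r(x_0):\,u(x)>c\}\big| > \alpha r^N$, and (b) $[u]_{s,p,Q_r(x_0)} \le \gamma\, c\, r^{\frac{N-ps}{p}}$, there exists a point $x_1\in Q_r(x_0)$ such that $$\big|\{x\in Q_{\eta r}(x_1):\,u(x)>\lambda c\}\big| > (1-\delta)(\eta r)^N.$$
   Context: For $x\in\mathbb{R}^N$ and $r>0$, $Q_r(x)=\prod_{i=1}^N\big(x^i-\frac r2,\,x^i+\frac r2\big)$ is the open cube centered at $x$ with side $r$. $|A|$ denotes the $N$-dimensional Lebesgue measure of $A\subset\mathbb{R}^N$. For an open set $\Omega\subset\mathbb{R}^N$ and a measurable $u:\Omega\to\mathbb{R}$, the Gagliardo seminorm is $$[u]_{s,p,\Omega}=\Big[\iint_{\Omega\times\Omega}\frac{|u(x)-u(y)|^p}{|x-y|^{N+ps}}\,dx\,dy\Big]^{\frac1p},$$ and $u\in W^{s,p}(\Omega)$ means that $u\in L^p(\Omega)$ and $[u]_{s,p,\Omega}<\infty$. Since $u$ is defined only on $Q_r(x_0)$, the set $\{x\in Q_{\eta r}(x_1):\,u(x)>\lambda c\}$ is understood as a subset of $Q_{\eta r}(x_1)\cap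 Q_r(x_0)$. *)

(* Defs.v *)
From HB Require Import structures.
From mathcomp Require Import all_boot all_order all_algebra.
From mathcomp Require Import all_classical all_reals all_analysis.
Set Implicit Arguments.
Unset Strict Implicit.
Unset Printing Implicit Defensive.
Import Order.TTheory GRing.Theory Num.Theory.
Import numFieldNormedType.Exports.
Local Open Scope classical_set_scope.
Local Open Scope ring_scope.

Notation Rn R n := (n.-tuple (measurableTypeR R)).

Section borel_lebesgue_measure.
Context (R : realType).
Local Open Scope ereal_scope.

Definition consRn n (z : measurableTypeR R * Rn R n) : Rn R n.+1 :=
  [tuple of z.1 :: z.2].

Lemma measurable_consRn n : measurable_fun [set: _ * _] (@consRn n).
Proof. exact: measurable_cons. Qed.

Section step.
Context (n : nat) (m : {sigma_finite_measure set (Rn R n) -> \bar R}).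

Definition leb_step : set (Rn R n.+1) -> \bar R :=
  pushforward (@lebesgue_measure R \x m) (@consRn n).

Let leb_step0 : leb_step set0 = 0.
Proof. by rewrite /leb_step /pushforward preimage_set0 measure0. Qed.

Let leb_step_ge0 A : 0 <= leb_step A.
Proof. by rewrite /leb_step /pushforward; exact: measure_ge0. Qed.

Let leb_step_sigma_additive : semi_sigma_additive leb_step.
Proof.
apply: (@measure_semi_sigma_additive _ _ _ (pushforward _ _)).
exact: measurable_consRn.
Qed.

HB.instance Definition _ := isMeasure.Build _ _ _ leb_step
  leb_step0 leb_step_ge0 leb_step_sigma_additive.

Let leb_step_sigma_finite : sigma_finite setT leb_step.
Proof.
have /sigma_finiteP[F [TF ndF Foo]] := sigma_finiteT (@lebesgue_measure R).
have /sigma_finiteP[G [TG ndG Goo]] := sigma_finiteT m.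
pose uncons (t : Rn R n.+1) : measurableTypeR R * Rn R n :=
  (thead t, [tuple of behead t]).
have consK : cancel (@consRn n) uncons.
  by move=> [x t]; rewrite /uncons/consRn/= theadE; congr pair; exact: val_inj.
have unconsK : cancel uncons (@consRn n).
  by move=> t; rewrite [RHS]tuple_eta; exact: val_inj.
have mU : measurable_fun [set: Rn R n.+1] uncons.
  by apply/measurable_fun_pairP; split;
    [exact: measurable_tnth|exact: measurable_behead].
exists (fun k => uncons @^-1` (F k `*` G k)).
  rewrite -preimage_bigcup -(preimage_setT uncons) -setXTT TF TG; congr preimage.
  apply/seteqP; split=> [[x t] [/= [i _ Fix] [j _ Gjt]]|[x t] [k _ [/= Fx Gt]]].
    exists (maxn i j) => //; split=> /=.
      by move: x Fix; exact/subsetPset/ndF/leq_maxl.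
    by move: t Gjt; exact/subsetPset/ndG/leq_maxr.
  by split; exists k.
move=> k; have [mF Fk] := Foo k; have [mG Gk] := Goo k; split.
  by rewrite -[X in measurable X]setTI; apply: mU => //; exact: measurableX.
rewrite /leb_step /pushforward -comp_preimage.
rewrite (_ : _ \o _ = id); last by apply/funext => x /=; rewrite consK.
by rewrite preimage_id product_measure1E// lte_mul_pinfty// ge0_fin_numE.
Qed.

HB.instance Definition _ :=
  Measure_isSigmaFinite.Build _ _ _ leb_step leb_step_sigma_finite.

End step.

(* On the Borel sets of R^n: the Dirac mass at the unique point when n = 0, and
   the product of the Lebesgue measures on R and on R^n for n.+1. *)
Fixpoint borel_lebesgue n : {sigma_finite_measure set (Rn R n) -> \bar R} :=
  if n is m.+1 then leb_step (borel_lebesgue m) else \d_([tuple] : Rn R 0).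

End borel_lebesgue_measure.

(* R^n with the Lebesgue-measurable sets and the (complete) Lebesgue measure,
   obtained from borel_lebesgue by Caratheodory's construction, exactly as the
   library's completed_lebesgue_measure is in dimension 1. *)
Definition leb_space (R : realType) (n : nat) : measurableType _ :=
  caratheodory_type (borel_lebesgue R n)^*%mu.

Definition leb (R : realType) (n : nat) : set (leb_space R n) -> \bar R :=
  @completed_measure_extension _ _ _ (borel_lebesgue R n).

HB.instance Definition _ (R : realType) (n : nat) := Measure.on (@leb R n).
HB.instance Definition _ (R : realType) (n : nat) :=
  Measure_isSigmaFinite.Build _ _ _ (@leb R n)
    (completed_measure_extension_sigma_finite
      (sigma_finiteT (borel_lebesgue R n))).

Section sobolev.
Context (R : realType) (n : nat).
Implicit Types (x y : leb_space R n) (u : leb_space R n -> R)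
  (Om : set (leb_space R n)) (r s p : R).

Definition coord x (i : 'I_n) : R := tnth (x : n.-tuple R) i.

Definition edist x y : R := Num.sqrt (\sum_(i < n) (coord x i - coord y i) ^+ 2).

Definition cube x r : set (leb_space R n) :=
  [set y | forall i, coord x i - r / 2 < coord y i < coord x i + r / 2].

(* On the diagonal the integrand is 0, since `|0| `^ p = 0 for p != 0. *)
Definition gagliardo s p Om u : \bar R :=
  ((\int[@leb R n \x @leb R n]_(z in Om `*` Om)
     (`|u z.1 - u z.2| `^ p / edist z.1 z.2 `^ (n%:R + p * s))%:E) `^ p^-1)%E.

(* u is total; only its values on Om matter. *)
Definition Wsp s p Om u : Prop :=
  [/\ measurable_fun Om u,
      (\int[@leb R n]_(x in Om) (`|u x| `^ p)%:E < +oo)%E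
    & (gagliardo s p Om u < +oo)%E].

End sobolev.

(* Main.v *)
(** Cut Q_r(x0) into k^N open cells of side q = r/k, which exhaust it up to a
    null set.  If {u > lambda c} filled more than a fraction 1 - delta of no
    cell, then |{u <= lambda c} in Q| >= delta q^N for every cell Q, and the
    pairs (x, y) in Q * Q with u x > c, u y <= lambda c would contribute at
    least ((1 - lambda) c)^p (sqrt N q)^-(N + ps) |{u > c} in Q| delta q^N to
    the Gagliardo integral.  Summing over the cells bounds that integral from
    below by const * c^p r^(N - ps) k^(ps), contradicting (b) for large k; so
    eta = 1/k works. *)
Require Import Defs.
From mathcomp Require Import all_boot all_order all_algebra.
From mathcomp Require Import all_classical all_reals all_analysis.
From mathcomp Require Import ring lra.
Set Implicit Arguments.
Unset Strict Implicit.
Unset Printing Implicit Defensive.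
Import Order.TTheory GRing.Theory Num.Theory.
Import numFieldNormedType.Exports.
Local Open Scope classical_set_scope.
Local Open Scope ring_scope.

(** * Finite disjoint unions and lower bounds for integrals *)

Lemma measure_bigcup_fin d (T : measurableType d) (R : realType)
    (mu : {measure set T -> \bar R}) (J : finType) (F : J -> set T) :
  (forall j, measurable (F j)) -> trivIset setT F ->
  mu (\bigcup_j F j) = (\sum_(j : J) mu (F j))%E.
Proof.
move=> mF tF; rewrite (measure_fin_bigcup mu finite_finset tF)//.
rewrite (fsbig_seq _ _ (index_enum_uniq J)); apply: eq_fsbigl.
by apply/seteqP; split=> // j _ /=; rewrite mem_index_enum.
Qed.

(** The integral is a supremum over simple functions below the integrand, and [K] times the
    indicator of [E] is one of them. Arguing this way avoids a measurability proof for the Gagliardo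
    integrand on the product space. *)
Lemma ge0_integral_ge_cst d (T : measurableType d) (R : realType)
    (mu : {measure set T -> \bar R}) (D E : set T) (f : T -> \bar R) (K : R) :
  measurable E -> E `<=` D -> 0 <= K ->
  (forall x, D x -> (0 <= f x)%E) -> (forall x, E x -> (K%:E <= f x)%E) ->
  (K%:E * mu E <= \int[mu]_(x in D) f x)%E.
Proof.
move=> mE ED K0 f0 fK; rewrite ge0_integralE//.
rewrite -(sintegral_EFin_cst mu E (NngNum K0)).
apply: ereal_sup_ubound.
exists (proj_nnsfun (cst_nnsfun T (NngNum K0)) mE) => /=.
  move=> x; rewrite /= /patch measurable_realfun.mindicE.
  case: (boolP (x \in E)) => [/set_mem xE|_].
    by rewrite mulr1 mem_set ?fK//; exact: ED.
  by rewrite mulr0; case: ifPn => // /set_mem; exact: f0.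
congr sintegral; apply/funext => x /=.
rewrite /patch measurable_realfun.mindicE.
by case: ifPn => _; rewrite ?mulr1 ?mulr0.
Qed.

(** * Measurability and volume of boxes and cubes *)

Lemma measurable_box (R : realType) n (a b : 'I_n -> R) :
  measurable [set t : Rn R n | forall i, a i < tnth t i < b i].
Proof.
rewrite (_ : [set _ | _] = \bigcap_(i in [set: 'I_n])
    ((fun t : Rn R n => tnth t i) @^-1` `]a i, b i[)).
  apply: fin_bigcap_measurable => // i _; rewrite -[X in measurable X]setTI.
  by apply: measurable_tnth => //; exact: measurable_itv.
apply/seteqP; split=> [t abt i _ /=|t abt i]; first by rewrite in_itv/= abt.
by have := abt i I; rewrite /= in_itv.
Qed.

(** By induction on the dimension: [consRn] pulls a box back to an interval times a box in the
    remaining coordinates. *)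
Lemma borel_lebesgue_box (R : realType) n (a b : 'I_n -> R) :
  (forall i, a i <= b i) ->
  borel_lebesgue R n [set t | forall i, a i < tnth t i < b i] =
  (\prod_(i < n) (b i - a i))%:E.
Proof.
elim: n a b => [|n ih] a b ab.
  by rewrite big_ord0/= diracE mem_set//= => -[].
rewrite /= /leb_step /pushforward.
rewrite (_ : _ @^-1` _ = `]a ord0, b ord0[%classic `*`
    [set t | forall i, a (lift ord0 i) < tnth t i < b (lift ord0 i)]).
  rewrite product_measure1E; [|exact: measurable_itv|exact: measurable_box].
  rewrite ih// big_ord_recl EFinM; congr (_ * _)%E.
  apply: etrans (lebesgue_measure_itv _) _; rewrite /= lte_fin.
  (* An empty interval falls in the default case of measure 0, which agrees with its zero side
     length. *)
  have := ab ord0; rewrite le_eqVlt => /predU1P[<-|->//].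
  by rewrite ltxx subrr.
apply/seteqP; split=> [[x t] /= abt|[x t] /= [xab abt] i].
  split; first by have := abt ord0; rewrite in_itv/= (tnth_nth 0).
  by move=> i; have := abt (lift ord0 i); rewrite !(tnth_nth 0).
have [j ->|->] := unliftP ord0 i; last first.
  by move: xab; rewrite in_itv/= (tnth_nth 0).
by have := abt j; rewrite !(tnth_nth 0).
Qed.

Lemma measurable_cube (R : realType) n (x : leb_space R n) (r : R) :
  measurable (cube x r).
Proof.
apply: (@caratheodory_measurable_mu_ext _ _ _ (borel_lebesgue R n)).
exact: measurable_box.
Qed.

Lemma leb_cube (R : realType) n (x : leb_space R n) (r : R) :
  0 <= r -> leb (cube x r) = (r ^+ n)%:E.
Proof.
move=> r0; transitivity (borel_lebesgue R n (cube x r)).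
  (* The completed measure agrees with [borel_lebesgue] on Borel sets. *)
  exact: measurable_mu_extE (measurable_box _ _).
rewrite borel_lebesgue_box => [|i]; last by lra.
rewrite (eq_bigr (fun=> r)) => [|i _]; last by field.
by rewrite prodr_const card_ord.
Qed.

(** * The grid of open cells *)

(** [j i] counts steps of length [r / k] from the lower corner of the cube, starting at 0; the extra
    half step reaches the middle of the cell. *)
Definition grid_center (R : realType) n (x : leb_space R n) (r : R) k
    (j : {ffun 'I_n -> 'I_k}) : leb_space R n :=
  [tuple Defs.coord x i - r / 2 + ((j i)%:R + 2^-1) * (r / k%:R) | i < n].

Section grid.
Context (R : realType) (n : nat) (x : leb_space R n) (r : R) (k : nat).
Hypotheses (r0 : 0 < r) (k0 : (0 < k)%N).

Let kR0 : 0 < k%:R :> R. Proof. by rewrite ltr0n. Qed.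

Let q0 : 0 < r / k%:R. Proof. exact: divr_gt0. Qed.

Let cell (j : {ffun 'I_n -> 'I_k}) := cube (grid_center x r j) (r / k%:R).

Let coord_cell j y i : cell j y ->
  Defs.coord x i - r / 2 + (j i)%:R * (r / k%:R) < Defs.coord y i
    < Defs.coord x i - r / 2 + (j i).+1%:R * (r / k%:R).
Proof.
move=> /(_ i); rewrite /Defs.coord tnth_mktuple /Defs.coord -(natr1 (j i)).
by move=> /andP[h1 h2]; apply/andP; split; lra.
Qed.

Lemma grid_subset j : cell j `<=` cube x r.
Proof.
move=> y /coord_cell jy i; have /andP[h1 h2] := jy i.
have h3 : 0 <= (j i)%:R * (r / k%:R) by rewrite mulr_ge0// ltW.
have h4 : (j i).+1%:R * (r / k%:R) <= r.
  by rewrite mulrA ler_pdivrMr// mulrC ler_wpM2l ?(ltW r0)// ler_nat.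
apply/andP; split; lra.
Qed.

Lemma grid_center_in (j : {ffun 'I_n -> 'I_k}) : cube x r (grid_center x r j).
Proof.
apply: (@grid_subset j) => i; have := q0; move: (r / k%:R) => q q_gt0.
by apply/andP; split; lra.
Qed.

(** In each coordinate a common point lies strictly between two consecutive steps for both indices,
    so each index is less than the other plus one. *)
Lemma trivIset_grid : trivIset setT cell.
Proof.
move=> j1 j2 _ _ [y [/coord_cell y1 /coord_cell y2]].
apply/ffunP => i; apply/val_inj/eqP; rewrite eqn_leq.
have /andP[a1 b1] := y1 i; have /andP[a2 b2] := y2 i.
apply/andP; split; rewrite -ltnS -(ltr_nat R) -(ltr_pM2r q0); lra.
Qed.

(* The cells are disjoint and their volumes already add up to r ^+ n. *)
Lemma leb_grid_remainder : leb (cube x r `\` \bigcup_j cell j) = 0%E.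
Proof.
have mC j : measurable (cell j) by exact: measurable_cube.
have mU : measurable (\bigcup_j cell j) by exact: fin_bigcup_measurable.
have xE : leb (cube x r) = (r ^+ n)%:E by rewrite leb_cube ?ltW.
have UE : leb (\bigcup_j cell j) = (r ^+ n)%:E.
  apply: etrans (measure_bigcup_fin (@leb R n) mC trivIset_grid) _.
  rewrite (eq_bigr (fun=> ((r / k%:R) ^+ n)%:E)) => [|j _]; last first.
    by rewrite -(leb_cube (grid_center x r j)) ?(ltW q0).
  rewrite sumEFin sumr_const card_ffun !card_ord.
  rewrite expr_div_n -[_ *+ (k ^ n)]mulr_natr natrX divfK//.
  by rewrite expf_neq0// gt_eqF.
rewrite measureD//; [|exact: measurable_cube|by rewrite /= xE ltry].
rewrite setIidr => [|y [j _]]; last exact: grid_subset.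
by rewrite /= xE UE -EFinB subrr.
Qed.

(** The open cells miss the faces between them, but that leftover is null; additivity over the
    disjoint cells does the rest. *)
Lemma leb_grid (A : set (leb_space R n)) : measurable A -> A `<=` cube x r ->
  leb A = (\sum_j leb (A `&` cell j))%E.
Proof.
move=> mA Ax.
have mC j : measurable (cell j) by exact: measurable_cube.
have mU : measurable (\bigcup_j cell j) by exact: fin_bigcup_measurable.
have A0 : leb (A `\` \bigcup_j cell j) = 0%E.
  apply: subset_measure0 leb_grid_remainder.
  - exact: measurableD.
  - by apply: measurableD => //; exact: measurable_cube.
  - exact: setSD.
apply: etrans (measureDI (@leb R n) mA mU) _.
rewrite /= A0 add0e setI_bigcupr.
apply: (measure_bigcup_fin (@leb R n)) => [j|]; first exact: measurableI.
exact/trivIset_setIl/trivIset_grid.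
Qed.

End grid.

(** * Distances within a cell and the Gagliardo integral *)

Lemma euclidean_dist_gt0 (R : realType) n (x y : leb_space R n) :
  x != y -> 0 < Defs.edist x y.
Proof.
move=> xy; rewrite /Defs.edist sqrtr_gt0 lt_def sumr_ge0 ?andbT => [|i _];
  last first.
  exact: sqr_ge0.
apply: contraNneq xy => /eqP; rewrite psumr_eq0 => [/allP s0|i _]; last first.
  exact: sqr_ge0.
apply/eqP/eq_from_tnth => i; have := s0 i (mem_index_enum i).
by rewrite sqrf_eq0 subr_eq0 => /eqP.
Qed.

Lemma euclidean_dist_cube (R : realType) n (x y z : leb_space R n) (q : R) :
  cube z q x -> cube z q y -> Defs.edist x y <= Num.sqrt n%:R * q.
Proof.
(* In dimension 0 the side [q] may be negative, but both sides of the bound vanish; otherwise a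
   point of the cube forces [q] to be positive. *)
move=> xq yq; have [n0|n0] := posnP n.
  by subst n; rewrite /Defs.edist big_ord0 sqrtr0 mul0r.
have q0 : 0 <= q.
  by have /andP[h1 h2] := xq (Ordinal n0); have := lt_trans h1 h2; lra.
rewrite -[q in leRHS](ger0_norm q0) -sqrtr_sqr -sqrtrM// ler_wsqrtr//.
rewrite mulr_natl -[X in _ *+ X](card_ord n) -sumr_const.
apply: ler_sum => i _; have /andP[h1 h2] := xq i; have /andP[h3 h4] := yq i.
by rewrite -subr_ge0 subr_sqr mulr_ge0//; lra.
Qed.

(** On the product of [A j] and [B j] the numerator is at least [(b - a)^p] and the denominator at
    most [d^(n + ps)]. These products are disjoint because their first factors are. *)
Lemma gagliardo_integral_ge (R : realType) n (s p b a d : R) (J : finType)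
    (Om : set (leb_space R n)) (u : leb_space R n -> R)
    (A B : J -> set (leb_space R n)) :
  0 <= p -> 0 < n%:R + p * s -> a < b ->
  (forall j, measurable (A j)) -> (forall j, measurable (B j)) ->
  (forall j, A j `<=` Om) -> (forall j, B j `<=` Om) -> trivIset setT A ->
  (forall j x, A j x -> b < u x) -> (forall j x, B j x -> u x <= a) ->
  (forall j x y, A j x -> B j y -> Defs.edist x y <= d) ->
  (((b - a) `^ p / d `^ (n%:R + p * s))%:E * \sum_j (leb (A j) * leb (B j)) <=
   \int[@leb R n \x @leb R n]_(z in Om `*` Om)
     (`|u z.1 - u z.2| `^ p / Defs.edist z.1 z.2 `^ (n%:R + p * s))%:E)%E.
Proof.
move=> p0 e0 ab mA mB AO BO tA Au Bu ABd.
have mAB j : measurable (A j `*` B j) by exact: measurableX.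
have tAB : trivIset setT (fun j => A j `*` B j).
  by move=> i j _ _ [z [[Ai _] [Aj _]]]; apply: tA => //; exists z.1.
have E : (\sum_j (leb (A j) * leb (B j)) =
    (@leb R n \x @leb R n) (\bigcup_j (A j `*` B j)))%E.
  rewrite (measure_bigcup_fin (@leb R n \x @leb R n)%E mAB tAB).
  apply: eq_bigr => j _; symmetry.
  exact: (product_measure1E (@leb R n) (@leb R n)).
rewrite E; apply: ge0_integral_ge_cst.
- exact: fin_bigcup_measurable.
- by move=> z [j _ [/AO ? /BO ?]].
- by rewrite divr_ge0// powR_ge0.
- by move=> z _; rewrite lee_fin divr_ge0// powR_ge0.
- move=> z [j _ [Az Bz]]; rewrite lee_fin.
  have ub := Au _ _ Az; have ua := Bu _ _ Bz.
  (* The values of [u] differ, hence so do the points: the distance is positive and the inequality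
     between denominators can be inverted. *)
  have z12 : z.1 != z.2 by apply: contraTneq ub => ->; lra.
  have z0 := euclidean_dist_gt0 z12; have zd := ABd _ _ _ Az Bz.
  apply: ler_pM => //; rewrite ?powR_ge0 ?invr_ge0 ?powR_ge0//.
    apply: ge0_ler_powR; rewrite ?nnegrE//; first by rewrite subr_ge0 ltW.
    by rewrite ger0_norm; lra.
  rewrite lef_pV2 ?posrE ?powR_gt0//; last exact: lt_le_trans zd.
  by apply: ge0_ler_powR; rewrite ?nnegrE ?(ltW e0)// ltW// (lt_le_trans z0).
Qed.
(** Both sides scale as [c^p r^(n - ps)], and the right one also carries [k^(ps)]; so a single [k]
    serves all [r] and [c], and [T < k^(ps)] suffices. *)
Lemma subdivision_exists (R : realType) (n : nat)
    (s p alpha gamma delta lambda : R) :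
  (0 < n)%N -> 0 < s -> 0 < p -> 0 < alpha -> 0 < gamma -> 0 < delta ->
  lambda < 1 ->
  exists2 k : nat, (1 < k)%N & forall r c : R, 0 < r -> 0 < c ->
    (gamma * c * r `^ ((n%:R - p * s) / p)) `^ p <
    (c - lambda * c) `^ p / (Num.sqrt n%:R * (r / k%:R)) `^ (n%:R + p * s) *
      (alpha * r ^+ n * (delta * (r / k%:R) ^+ n)).
Proof.
move=> n0 s0 p0 a0 g0 d0 l1.
have ps0 : 0 < p * s by rewrite mulr_gt0.
have l10 : 0 < 1 - lambda by rewrite subr_gt0.
have w0 : 0 < Num.sqrt n%:R :> R by rewrite sqrtr_gt0 ltr0n.
pose W := Num.sqrt n%:R `^ (n%:R + p * s) : R.
have W0 : 0 < W by exact: powR_gt0.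
pose T := gamma `^ p * W / ((1 - lambda) `^ p * alpha * delta).
have V0 : 0 < (1 - lambda) `^ p * alpha * delta by rewrite !mulr_gt0// powR_gt0.
have T0 : 0 < T by rewrite divr_gt0// mulr_gt0// powR_gt0.
(* One unit puts [k] above [T^(1/(ps))]; the second ensures [1 < k]. *)
pose k := (Num.truncn (T `^ (p * s)^-1)).+2.
have k0 : 0 < k%:R :> R by rewrite ltr0n.
have kT : T < k%:R `^ (p * s).
  rewrite -[T]powRr1 ?(ltW T0)//.
  rewrite -[X in T `^ X](mulVf (lt0r_neq0 ps0)) (powRrM T).
  apply: gt0_ltr_powR => //; rewrite ?nnegrE ?powR_ge0 ?(ltW k0)//.
  by apply: lt_le_trans (truncnS_gt _) _; rewrite ler_nat.
exists k => // r c r0 c0.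
have q0 : 0 < r / k%:R by exact: divr_gt0.
rewrite [(gamma * c * _) `^ p]powRM ?mulr_ge0 ?powR_ge0 ?(ltW g0) ?(ltW c0)//.
rewrite [(gamma * c) `^ p]powRM ?(ltW g0) ?(ltW c0)//.
rewrite -(powRrM r) divfK ?(gt_eqF p0)//.
rewrite (_ : c - lambda * c = (1 - lambda) * c); last by ring.
rewrite [((1 - lambda) * c) `^ p]powRM ?(ltW l10) ?(ltW c0)//.
rewrite [(Num.sqrt _ * _) `^ _]powRM ?(ltW w0) ?(ltW q0)// -/W.
(* The factor [(r/k)^n] split off here cancels against the volume of a cell. *)
rewrite [(r / k%:R) `^ _]powRD; last by rewrite (gt_eqF q0) implybT.
rewrite powRB; last by rewrite (gt_eqF r0) implybT.
rewrite !powR_mulrn ?(ltW q0) ?(ltW r0)//.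
rewrite [(r / k%:R) `^ _]powRM ?invr_ge0 ?(ltW r0) ?(ltW k0)//.
rewrite -[k%:R^-1]powR_inv1 ?(ltW k0)// -(powRrM k%:R) mulN1r.
rewrite powR_inv1 ?(ltW k0)// powRN.
have c1 : 0 < c `^ p by exact: powR_gt0.
have r1 : 0 < r `^ (p * s) by exact: powR_gt0.
have r2 : 0 < r ^+ n by exact: exprn_gt0.
have q2 : 0 < (r / k%:R) ^+ n by exact: exprn_gt0.
have k1 : 0 < k%:R `^ (p * s) by exact: powR_gt0.
move: kT; rewrite /T ltr_pdivrMr// => kT.
rewrite -subr_gt0.
set g := gamma `^ p in kT *; set L := (1 - lambda) `^ p in kT *.
set K := k%:R `^ (p * s) in kT k1 *.
set Q := (r / k%:R) ^+ n in q2 *.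
set C := c `^ p in c1 *; set P := r `^ (p * s) in r1 *; set X := r ^+ n in r2 *.
rewrite (_ : _ - _ = C * X / P / W * (K * (L * alpha * delta) - g * W)).
  by rewrite mulr_gt0 ?subr_gt0// !mulr_gt0// invr_gt0.
field; rewrite !gt_eqF//.
Qed.
Theorem theorem1p1 (R : realType) (N : nat) (s p : R) (x0 : leb_space R N)
    (r c alpha gamma delta lambda : R)
    (hN : (2 <= N)%N) (hs : 0 < s < 1) (hp : 1 <= p) (hr : 0 < r) (hc : 0 < c)
    (halpha : 0 < alpha < 1) (hgamma : 0 < gamma)
    (hdelta : 0 < delta < 1) (hlambda : 0 < lambda < 1) :
  exists2 eta : R, 0 < eta < 1 &
    forall u : leb_space R N -> R,
      Wsp s p (cube x0 r) u ->
      ((alpha * r ^+ N)%:E < leb [set x | cube x0 r x /\ (c < u x)%R])%E ->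
      (gagliardo s p (cube x0 r) u
         <= (gamma * c * r `^ ((N%:R - p * s) / p))%:E)%E ->
      exists2 x1 : leb_space R N, cube x0 r x1 &
        (((1 - delta) * (eta * r) ^+ N)%:E
           < leb [set x | (cube x1 (eta * r) `&` cube x0 r) x
                          /\ (lambda * c < u x)%R])%E.
Proof.
have /andP[s0 _] := hs; have /andP[a0 _] := halpha; have /andP[d0 _] := hdelta.
have /andP[_ l1] := hlambda.
have p0 : 0 < p by exact: lt_le_trans hp.
have [k k1 kP] := subdivision_exists (ltnW hN) s0 p0 a0 hgamma d0 l1.
have k0 : (0 < k)%N by exact: ltnW.
have kR0 : 0 < k%:R :> R by rewrite ltr0n.
(* With this choice [eta * r] is the side of a cell, and [1 < k] gives [eta < 1]. *)
exists k%:R^-1; first by rewrite invr_gt0 kR0 invf_lt1// ltr1n.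
move=> u [mu _ _] ua ug; rewrite [_ * r]mulrC; set q := r / k%:R.
have q0 : 0 < q by exact: divr_gt0.
pose cell (j : {ffun 'I_N -> 'I_k}) := cube (grid_center x0 r j) q.
apply: contrapT => noball.
pose P := [set x | cube x0 r x /\ c < u x].
pose S := [set x | cube x0 r x /\ lambda * c < u x].
have mcube z t : measurable (cube z t) by exact: measurable_cube.
have msup t : measurable [set x | cube x0 r x /\ t < u x].
  rewrite (_ : [set _ | _] = cube x0 r `&` u @^-1` `]t, +oo[).
    exact: mu.
  by apply/seteqP; split=> x /=; rewrite in_itv/= andbT.
pose A j := P `&` cell j; pose B j := cell j `\` S.
have mA j : measurable (A j) by apply: measurableI; [exact: msup|exact: mcube].
have mB j : measurable (B j) by apply: measurableD; [exact: mcube|exact: msup].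
have cellS j : cell j `<=` cube x0 r by exact: grid_subset.
have Blarge j : ((delta * q ^+ N)%:E <= leb (B j))%E.
  have small : (leb (cell j `&` S) <= ((1 - delta) * q ^+ N)%:E)%E.
    (* The negated conclusion is applied only at the grid centers. *)
    rewrite leNgt; apply: contra_notN noball => large.
    exists (grid_center x0 r j); first exact: grid_center_in.
    by rewrite (_ : [set _ | _] = cell j `&` S)// setIA.
  have cellE : leb (cell j) = (q ^+ N)%:E by apply: leb_cube; exact: ltW.
  rewrite /B [leb _]measureD; [|exact: mcube|exact: msup|];
    last by rewrite /= cellE ltry.
  rewrite /= cellE leeBrDr; last first.
    by rewrite ge0_fin_numE ?measure_ge0// (le_lt_trans small)// ltry.
  apply: le_trans (leeD2l _ small) _.
  by rewrite -EFinD lee_fin; lra.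
have sumAB : ((alpha * r ^+ N * (delta * q ^+ N))%:E <=
    \sum_j (leb (A j) * leb (B j)))%E.
  (* Bounding each [leb (B j)] from below leaves the sum of the [leb (A j)], which is the measure of
     [P] by [leb_grid]. *)
  apply: (@le_trans _ _ (\sum_j leb (A j) * (delta * q ^+ N)%:E)%E); last first.
    by apply: lee_sum => j _; apply: lee_wpmul2l (Blarge j); exact: measure_ge0.
  rewrite -ge0_sume_distrl; last by move=> *; exact: measure_ge0.
  rewrite -(leb_grid hr k0 (msup c)) => [|x []//].
  rewrite EFinM lee_wpmul2r ?(ltW ua)// lee_fin.
  by rewrite mulr_ge0 ?exprn_ge0// ltW.
have := ug; rewrite /gagliardo; set I := integral _ _ _ => Ir.
have I0 : (0 <= I)%E.
  by apply: integral_ge0 => z _; rewrite lee_fin divr_ge0// powR_ge0.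
(* Hypothesis (b) bounds [I^(1/p)]; raising it to the power [p] in the extended reals bounds [I]
   itself. *)
have Ile : (I <= ((gamma * c * r `^ ((N%:R - p * s) / p)) `^ p)%:E)%E.
  have -> : I = ((I `^ p^-1) `^ p)%E.
    by rewrite -poweRrM mulVf ?lt0r_neq0// poweRe1.
  rewrite -poweR_EFin.
  apply: gt0_ler_poweR => //; first exact: ltW.
    by rewrite in_itv/= poweR_ge0 leey.
  by rewrite in_itv/= leey andbT lee_fin !mulr_ge0 ?powR_ge0// ltW.
have Ige : (((c - lambda * c) `^ p /
     (Num.sqrt N%:R * q) `^ (N%:R + p * s))%:E *
     \sum_j (leb (A j) * leb (B j)) <= I)%E.
  apply: gagliardo_integral_ge => //.
  - exact: ltW.
  - by rewrite addr_gt0 ?mulr_gt0// ltr0n ltnW.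
  - by rewrite gtr_pMl.
  - by move=> j x [[]].
  - by move=> j x [/cellS].
  - exact/trivIset_setIl/trivIset_grid.
  - by move=> j x [[]].
  (* Cells lie in the big cube, so a point of a cell outside [S] has [u x <= lambda * c]. *)
  - by move=> j x [jx] /not_andP[/(_ (cellS _ _ jx))//|/negP]; rewrite -leNgt.
  - by move=> j x y [_ jx] [jy _]; exact: euclidean_dist_cube jx jy.
have := le_trans (lee_wpmul2l _ sumAB) (le_trans Ige Ile).
rewrite -EFinM !lee_fin divr_ge0 ?powR_ge0// => /(_ isT).
by rewrite leNgt kP.
Qed.
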